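(* Let $n\ge 1$. For every parking function $f\in \mathrm{PF}_n$, $$\mathrm{pmaj}(\phi_n(f))=\mathrm{area}(f).$$
   Context: Let $n\geq 1$ and $[n]=\{1,\dots,n\}$. A parking function of size $n$ is a function $f:[n]\to[n]$ with $|f^{-1}(\{1,\dots,m\})|\ge m$ for all $m\in[n]$; $\mathrm{PF}_n$ is the set of these. Elements of $[n]$ are called labels. A parking function is identified with a labelled Dyck path from $(0,0)$ to $(n,n)$ (north and east unit steps, never below the diagonal $y=x$): the north steps on the line $x=i-1$ carry the labels in $f^{-1}(i)$, increasing from bottom to top. So label $\lambda$ lies in column $f(\lambda)$, and the rows, numbered $1,\dots,n$ from bottom to top, each contain exactly one label (the labels ordered by increasing $f(\lambda)$, ties broken by increasing $\lambda$). Area: $a_\lambda(f)$ is the number of whole unit squares between the path and the main diagonal $y=x$ in the row containing $\lambda$; if $\lambda$ is in row $i$, then $a_\lambda(f)=i-f(\lambda)$. $\mathrm{area}(f)=\sum_{\lambda\in[n]}a_\lambda(f)$. Diagonal inversions: $\mathrm{Dinv}(f)$ is the set of pairs $\{\lambda,\mu\}\subseteq[n]$ with $\lambda<\mu$ such that either (A) $f(\lambda)<f(\mu)$ and $a_\lambda(f)=a_\mu(f)$, or (B) $f(\lambda)>f(\mu)$ and $a_\lambda(f)+1=a_\mu(f)$. The map $\phi_n$: the dinv reading word of $f$ is the word $w_1w_2\cdots w_n$ listing all labels in increasing order with respect to the total order in which $\lambda$ precedes $\mu$ iff $a_\lambda(f)<a_\mu(f)$, or $a_\lambda(f)=a_\mu(f)$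 and $f(\lambda)<f(\mu)$. For $\lambda=w_j$ set $d_\lambda(f)=\#\{\{w_i,w_j\}\in\mathrm{Dinv}(f) : i<j\}$. Then $\phi_n:\mathrm{PF}_n\to\mathrm{PF}_n$ is defined by $(\phi_n(f))(w_i)=i-d_{w_i}(f)$ for all $i\in[n]$ (this is indeed a parking function). Pmaj: for $g\in\mathrm{PF}_n$ the permutation $\sigma_{\mathrm{pmaj}}(g)=\sigma_1\cdots\sigma_n$ (one-line notation) is defined as follows. Set $B_0'=\varnothing$, $\sigma_0=n+1$. For $m=1,\dots,n$: let $B_m=B_{m-1}'\cup g^{-1}(m)$ (always nonempty) and $X_m=\{a\in B_m: a<\sigma_{m-1}\}$; put $\sigma_m=\max X_m$ if $X_m\ne\varnothing$ and $\sigma_m=\max B_m$ otherwise; let $B_m'=B_m\setminus\{\sigma_m\}$. Then $\mathrm{pmaj}(g)=\mathrm{maj}(\sigma_n\sigma_{n-1}\cdots\sigma_1)$, where for a permutation $\tau$ of $[n]$, $\mathrm{maj}(\tau)=\sum_{i\in[n-1],\ \tau(i)>\tau(i+1)} i$. *)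

(* Defs.v *)
From HB Require Import structures.
From mathcomp Require Import all_boot.

Set Implicit Arguments.
Unset Strict Implicit.
Unset Printing Implicit Defensive.

(* Indices start at 0: the label (or column, row, position) k of
   [n] = {1, ..., n} is represented by the ordinal k - 1 of 'I_n. *)

Definition parking n (f : {ffun 'I_n -> 'I_n}) : bool :=
  [forall m : 'I_n, m.+1 <= #|f @^-1: [set k : 'I_n | k <= m]|].

Record PF (n : nat) := ParkingFunction {
  PF_val :> {ffun 'I_n -> 'I_n};
  PF_valP : parking PF_val
}.

HB.instance Definition _ n := [isSub for @PF_val n].
HB.instance Definition _ n := [Finite of PF n by <:].

Section DyckPath.
Variables (n : nat) (f : PF n).
Implicit Types la mu : 'I_n.

Definition row la : nat :=
  #|[set mu | (f mu < f la) || (f mu == f la) && (mu < la)]|.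

(* The subtraction does not truncate: see col_le_row below. *)
Definition area_at la : nat := row la - f la.

Definition area : nat := \sum_la area_at la.

(* dinv_pair la mu is meaningful for la < mu only. *)
Definition dinv_pair la mu : bool :=
  (f la < f mu) && (area_at la == area_at mu)
  || (f mu < f la) && ((area_at la).+1 == area_at mu).

Definition Dinv : {set {set 'I_n}} :=
  [set [set p.1; p.2] | p : 'I_n * 'I_n & (p.1 < p.2) && dinv_pair p.1 p.2].

Definition precedes la mu : bool :=
  (area_at la < area_at mu)
  || (area_at la == area_at mu) && (f la < f mu).

Definition reading_word : seq 'I_n :=
  sort (fun la mu => (la == mu) || precedes la mu) (enum 'I_n).

Definition position la : nat := index la reading_word.

Definition dinv_at la : nat :=
  #|[set s in Dinv | s \in [set [set mu; la] | mu : 'I_n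
                                              & position mu < position la]]|.

Lemma col_le_row la : f la <= row la.
Proof.
case Ef: (val (f la)) => [//|k].
have k_lt_n : k < n by rewrite ltnW // -Ef ltn_ord.
have /forallP/(_ (Ordinal k_lt_n))/leq_trans := PF_valP f.
apply; apply/subset_leq_card/subsetP => mu.
by rewrite !inE /= Ef ltnS => ->.
Qed.

Lemma mem_reading_word la : la \in reading_word.
Proof. by rewrite mem_sort mem_enum. Qed.

Lemma size_reading_word : size reading_word = n.
Proof. by rewrite size_sort size_enum_ord. Qed.

Lemma uniq_reading_word : uniq reading_word.
Proof. by rewrite sort_uniq enum_uniq. Qed.

Lemma position_lt la : position la < n.
Proof. by rewrite -[X in _ < X]size_reading_word index_mem mem_reading_word. Qed.

Lemma dinv_at_le_position la : dinv_at la <= position la.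
Proof.
set P := [set mu | position mu < position la].
apply: (@leq_trans #|[set [set mu; la] | mu in P]|).
  by apply/subset_leq_card/subsetP => s /setIdP[].
apply: leq_trans (leq_imset_card _ _) _.
have pos_inj : injective position.
  move=> x y /(congr1 (nth la reading_word)).
  by rewrite !nth_index ?mem_reading_word.
pose ord_pos mu := Ordinal (position_lt mu).
have ord_pos_inj : injective ord_pos by move=> x y [] /pos_inj.
pose lift_la := widen_ord (ltnW (position_lt la)).
have lift_inj : injective lift_la by move=> x y [] /val_inj.
rewrite -(card_image ord_pos_inj) -[X in _ <= X]card_ord.
rewrite -(card_image lift_inj).
apply/subset_leq_card/subsetP => _ /imageP[mu +->]; rewrite inE => Pmu.
by apply/imageP; exists (Ordinal (Pmu : _ < _)) => //; apply: val_inj.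
Qed.

Lemma phi_val_lt la : position la - dinv_at la < n.
Proof. exact: leq_ltn_trans (leq_subr _ _) (position_lt la). Qed.

(* The subtraction does not truncate, by dinv_at_le_position; the shifts by 1
   of the values and of the positions cancel. *)
Definition phi_val : {ffun 'I_n -> 'I_n} :=
  [ffun la => Ordinal (phi_val_lt la)].

Lemma phi_parking : parking phi_val.
Proof.
apply/forallP => m.
pose w (i : 'I_m.+1) := nth m reading_word i.
have ltw (i : 'I_m.+1) : i < size reading_word.
  by rewrite size_reading_word (leq_trans (ltn_ord i)).
have w_inj : injective w.
  move=> i j /eqP; rewrite nth_uniq ?uniq_reading_word // => /eqP.
  exact: val_inj.
rewrite -[X in X <= _](card_ord m.+1) -(card_image w_inj).
apply/subset_leq_card/subsetP => _ /imageP[i _ ->].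
rewrite !inE ffunE /= (leq_trans (leq_subr _ _)) //.
by rewrite /position index_uniq ?uniq_reading_word // -ltnS.
Qed.

Definition phi : PF n := ParkingFunction phi_parking.

End DyckPath.

(* maj of a word tau(1) ... tau(k): tau(i) is nth 0 tau i.-1. *)
Definition maj (tau : seq nat) : nat :=
  \sum_(1 <= i < size tau | nth 0 tau i < nth 0 tau i.-1) i.

Section Pmaj.
Variables (n : nat) (g : PF n).

(* From (B'_(m-1), sigma_(m-1)) and the column m to (B'_m, sigma_m). *)
Definition pmaj_step (st : {set 'I_n} * nat) (m : 'I_n) : {set 'I_n} * nat :=
  let B := st.1 :|: g @^-1: [set m] in
  let X := [set a in B | a < st.2] in
  let sigma := \max_(a in if X != set0 then X else B) a in
  ([set a in B | a != sigma :> nat], sigma).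

(* The initial value sigma_0 = n+1 becomes n after the shift of labels. *)
Definition sigma_pmaj : seq nat :=
  [seq st.2 | st <- scanl pmaj_step (set0, n) (enum 'I_n)].

Definition pmaj : nat := maj (rev sigma_pmaj).

End Pmaj.

(* Main.v *)
(* Let tau (diagonal_word) list the labels by increasing area, and by decreasing
   label within each area. The word sigma_pmaj of phi f is tau, and summation by
   parts turns maj of the reversal of tau into the sum of the areas, because the
   ascents of tau are exactly the places where the area grows, by one.

   Label a is available at the step of its position in tau (phi_le_index), so
   it remains to see that a is not chosen earlier. This holds because phi f a
   exceeds the number of labels of far_before a (far_before_lt_phi): once a is
   available, the labels of tau between far_before a and a are first smaller
   than a, then larger than a, so the cyclically decreasing choice never passes
   over a. *)

Require Import Defs.
From mathcomp Require Import all_boot zify.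

Set Implicit Arguments.
Unset Strict Implicit.
Unset Printing Implicit Defensive.

(** * Words sorted by a strict total order *)

Section StrictTotalOrder.
Variables (T : finType) (r : rel T).
Hypotheses (r_irr : irreflexive r) (r_trans : transitive r).
Hypothesis r_total : forall x y, x != y -> r x y || r y x.

(** Same shape as [reading_word], which is thus an instance by conversion. *)
Definition order_word : seq T :=
  sort (fun x y => (x == y) || r x y) (enum T).

Lemma mem_order_word x : x \in order_word.
Proof. by rewrite mem_sort mem_enum. Qed.

Lemma order_word_uniq : uniq order_word.
Proof. by rewrite sort_uniq enum_uniq. Qed.

Lemma size_order_word : size order_word = #|T|.
Proof. by rewrite size_sort cardE. Qed.

Lemma index_order_word_lt x y :
  (index x order_word < index y order_word) = r x y.
Proof.
have lt_r u v : index u order_word < index v order_word -> r u v.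
  move=> lt_uv; have ne_uv : u != v by apply: contraTneq lt_uv => ->; rewrite ltnn.
  pose le x y := (x == y) || r x y.
  have le_trans : transitive le.
    move=> b a c /orP[/eqP-> //|ab] /orP[/eqP<-|bc]; rewrite /le ?ab ?orbT //.
    by rewrite (r_trans ab bc) orbT.
  have le_sorted : sorted le order_word.
    apply: sort_sorted => a b; rewrite /le.
    by have [//|/r_total/orP[]->] := eqVneq a b; rewrite ?orbT.
  have := sorted_ltn_index le_trans le_sorted.
  move=> /(_ u v (mem_order_word u) (mem_order_word v) lt_uv).
  by rewrite /le (negPf ne_uv).
apply/idP/idP => [/lt_r//|rxy]; rewrite ltnNge leq_eqVlt; apply/norP; split.
  apply: contraTneq rxy => /(congr1 (nth x order_word)).
  by rewrite !nth_index ?mem_order_word // => ->; rewrite r_irr.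
by apply/negP => /lt_r/(r_trans rxy); rewrite r_irr.
Qed.

(** Turns positions in words into cardinals, so that they can be compared through inclusions of
    sets. *)
Lemma index_order_word x : index x order_word = #|[set y | r y x]|.
Proof.
have -> : [set y | r y x] = [set y in take (index x order_word) order_word].
  by apply/setP => y; rewrite !inE in_take ?mem_order_word // index_order_word_lt.
rewrite cardsE (card_uniqP (take_uniq _ order_word_uniq)) size_take.
by rewrite index_mem mem_order_word.
Qed.

Lemma card_below_inj : injective (fun x => #|[set y | r y x]|).
Proof.
move=> x y; rewrite -!index_order_word => /(congr1 (nth x order_word)).
by rewrite !nth_index ?mem_order_word.
Qed.

End StrictTotalOrder.

(** * Major index of a reversed word *)

Lemma maj_rcons s x :
  maj (rcons s x) = maj s + if x < last x s then size s else 0.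
Proof.
rewrite /maj size_rcons; case/lastP: s => [|s y].
  by rewrite !big_geq //= ltnn.
rewrite last_rcons size_rcons [LHS]big_mkcond big_nat_recr //= -big_mkcond /=.
congr (_ + _).
  rewrite big_nat_cond [RHS]big_nat_cond; apply: eq_bigl => i.
  rewrite ![nth _ (rcons _ x) _]nth_rcons size_rcons.
  case/boolP: (1 <= i < _) => //= /andP[i_gt0 i_lt].
  by rewrite i_lt (leq_ltn_trans (leq_pred i)).
by rewrite !nth_rcons !size_rcons ltnn eqxx ltnSn ltnn eqxx.
Qed.

(* Summation by parts: each ascent [u < v] of the word raises the level by one
   for the whole suffix starting at [v], and is a descent of the reversed word
   at a position equal to the length of that suffix. *)
Lemma maj_rev_levels (T : Type) (val lv : T -> nat) x s :
    path (fun u v => lv v == lv u + (val u < val v)) x s ->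
  maj (rev (map val (x :: s))) + (size s).+1 * lv x = \sum_(y <- x :: s) lv y.
Proof.
elim: s x => [|y s IHs] x /=.
  by move=> _; rewrite big_seq1 mul1n /maj big_geq.
case/andP=> /eqP lvy /IHs eq_y; rewrite big_cons -eq_y.
rewrite rev_cons maj_rcons {2}rev_cons last_rcons size_rev /= size_map lvy.
by case: ltnP => _ /=; lia.
Qed.

(** * Rows and areas *)

Section ParkingFunction.
Variables (n : nat) (f : PF n).
Implicit Types la mu : 'I_n.

Definition lex la mu := (f la < f mu) || (f la == f mu) && (la < mu).

Lemma lex_irr : irreflexive lex.
Proof. by move=> la; rewrite /lex !ltnn andbF. Qed.

Lemma lex_trans : transitive lex.
Proof. by move=> y x z; rewrite /lex -!val_eqE /=; lia. Qed.

Lemma lex_total la mu : la != mu -> lex la mu || lex mu la.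
Proof. by rewrite /lex -!val_eqE /=; lia. Qed.

Lemma row_index la : row f la = index la (order_word lex).
Proof. by rewrite (index_order_word lex_irr lex_trans lex_total). Qed.

Lemma row_lt la mu : (row f la < row f mu) = lex la mu.
Proof. by rewrite !row_index (index_order_word_lt lex_irr lex_trans lex_total). Qed.

Lemma row_inj : injective (row f).
Proof. exact: (card_below_inj lex_irr lex_trans lex_total). Qed.

Lemma area_col_inj la mu : area_at f la = area_at f mu -> f la = f mu -> la = mu.
Proof.
move=> eq_a eq_f; apply: row_inj; move: (col_le_row f la) (col_le_row f mu) eq_a.
by rewrite /area_at eq_f; lia.
Qed.

(* Going down the rows from la, the area drops by at most one at each step and
   drops only within a column. *)
Lemma area_climb la k : k < area_at f la ->
  exists rho ka, [/\ area_at f rho = k, area_at f ka = k.+1,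
                     rho < ka, f rho = f ka & f ka <= f la].
Proof.
move: {2}(row f la) (erefl (row f la)) => i; elim: i la => [|i IHi] la row_la k_lt.
  by rewrite /area_at row_la in k_lt.
have i_lt : i < size (order_word lex).
  by rewrite ltnW // -row_la row_index index_mem mem_order_word.
pose mu := nth la (order_word lex) i.
have row_mu : row f mu = i by rewrite row_index index_uniq // order_word_uniq.
have lex_mu : lex mu la by rewrite -row_lt row_mu row_la.
have fmu_le : f mu <= f la by move: lex_mu; rewrite /lex -val_eqE /=; lia.
have [k_lt_mu|mu_le] := ltnP k (area_at f mu).
  have [rho [ka [? ? ? ? le_ka]]] := IHi mu row_mu k_lt_mu.
  by exists rho, ka; split=> //; apply: leq_trans le_ka fmu_le.
move: (col_le_row f la) (col_le_row f mu) k_lt mu_le lex_mu.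
rewrite /area_at row_la row_mu /lex -val_eqE /= => ? ? ? ? ?.
(* The area passes [k] between the adjacent rows of [mu] and [la], which forces the areas [k] and
   [k.+1] and a common column. *)
exists mu, la; rewrite /area_at row_la row_mu; split; try lia.
by apply: val_inj => /=; lia.
Qed.

(** * Reading word and diagonal inversions *)

Lemma precedes_irr : irreflexive (precedes f).
Proof. by move=> la; rewrite /precedes !ltnn andbF. Qed.

Lemma precedes_trans : transitive (precedes f).
Proof. by move=> y x z; rewrite /precedes; lia. Qed.

Lemma precedes_total la mu : la != mu -> precedes f la mu || precedes f mu la.
Proof.
move=> ne; rewrite /precedes.
have [eq_a|] := eqVneq (area_at f la) (area_at f mu); last by lia.
have : f la != f mu by apply: contra_neq ne; apply: area_col_inj.
by rewrite -val_eqE eq_a /=; lia.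
Qed.

Lemma position_card la : position f la = #|[set mu | precedes f mu la]|.
Proof. exact: (index_order_word precedes_irr precedes_trans precedes_total). Qed.

Lemma position_lt_precedes la mu :
  (position f la < position f mu) = precedes f la mu.
Proof. exact: (index_order_word_lt precedes_irr precedes_trans precedes_total). Qed.

(** In both kinds of diagonal inversion the smaller label comes first in the reading word, so the
    partners counted by [dinv_at] are all smaller than [la]. *)
Definition dinv_below la := [set mu : 'I_n | (mu < la) &&
  ((area_at f mu == area_at f la) && (f mu < f la) ||
   ((area_at f mu).+1 == area_at f la) && (f la < f mu))].

Lemma dinv_at_card la : dinv_at f la = #|dinv_below la|.
Proof.
rewrite /dinv_at.
have in_pair (x y : 'I_n) : x \in [set x; y] by rewrite !inE eqxx.
have in_pair' (x y : 'I_n) : y \in [set x; y] by rewrite !inE eqxx orbT.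
rewrite -(card_in_imset (f := fun mu => [set mu; la])); last first.
  move=> x y; rewrite !inE => /andP[ltx _] /andP[lty _] /setP/(_ x).
  rewrite !inE eqxx /= => /esym/orP[/eqP//|/eqP eq_x].
  by rewrite eq_x ltnn in ltx.
apply: eq_card => s; rewrite inE; apply/andP/imsetP => [[]|[mu]].
  case/imsetP=> -[x y]; rewrite inE /= => /andP[lt_xy dinv_xy] -> {s}.
  case/imsetP=> mu; rewrite inE position_lt_precedes => mu_la eq_s.
  have ne : mu != la by apply: contraTneq mu_la => ->; rewrite precedes_irr.
  have /setP eqs := eq_s.
  have := eqs x; have := eqs y; have := eqs mu; have := eqs la.
  rewrite !inE !eqxx /= !orbT /= => h1 h2 h3 h4.
  have [[ex ey]|[ex ey]] : (x = mu /\ y = la) \/ (x = la /\ y = mu).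
    move: h1 h2 h3 h4 ne lt_xy; rewrite -!val_eqE /= => h1 h2 h3 h4 ne lt_xy.
    have [[? ?]|[? ?]] : (val x = val mu /\ val y = val la)
                      \/ (val x = val la /\ val y = val mu) by move=> /=; lia.
      by left; split; apply: val_inj.
    by right; split; apply: val_inj.
  - exists mu => //; rewrite inE; move: lt_xy dinv_xy mu_la.
    by rewrite ex ey /dinv_pair /precedes; lia.
  - by move: dinv_xy mu_la; rewrite ex ey /dinv_pair /precedes; lia.
rewrite inE => /andP[lt_mu dinv_mu] ->; split.
  apply/imsetP; exists (mu, la) => //; rewrite inE lt_mu /= /dinv_pair.
  by move: dinv_mu; lia.
apply/imsetP; exists mu => //; rewrite inE position_lt_precedes /precedes.
by move: dinv_mu; lia.
Qed.

Lemma phiE la : phi f la = position f la - dinv_at f la :> nat.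
Proof. by rewrite /phi /= ffunE. Qed.

(** * The diagonal word and the bounds on [phi] *)

Definition before la mu :=
  (area_at f la < area_at f mu) || (area_at f la == area_at f mu) && (mu < la).

Lemma before_irr : irreflexive before.
Proof. by move=> la; rewrite /before !ltnn andbF. Qed.

Lemma before_trans : transitive before.
Proof. by move=> y x z; rewrite /before; lia. Qed.

Lemma before_total la mu : la != mu -> before la mu || before mu la.
Proof. by rewrite /before -val_eqE /=; lia. Qed.

Definition diagonal_word := order_word before.

Lemma size_diagonal_word : size diagonal_word = n.
Proof. by rewrite size_order_word card_ord. Qed.

Lemma index_diagonal_word la : index la diagonal_word = #|[set mu | before mu la]|.
Proof. exact: (index_order_word before_irr before_trans before_total). Qed.

Lemma index_diagonal_word_lt la mu :
  (index la diagonal_word < index mu diagonal_word) = before la mu.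
Proof. exact: (index_order_word_lt before_irr before_trans before_total). Qed.

(** A label preceding [la] in the reading word but not in the diagonal word has the same area, an
    earlier column and a smaller value, so it forms a diagonal inversion with [la]. *)
Lemma phi_le_index la : phi f la <= index la diagonal_word.
Proof.
rewrite phiE position_card dinv_at_card index_diagonal_word leq_subLR.
apply: leq_trans (leq_card_setU _ _); apply/subset_leq_card/subsetP => mu.
rewrite !inE /precedes /before.
have [/val_inj-> |] := eqVneq (val mu) la; first by rewrite !ltnn andbF.
by move=> /=; lia.
Qed.

(** The labels that would still come before [la] if their area were raised by one. *)
Definition far_before la := [set mu : 'I_n | ((area_at f mu).+1 < area_at f la)
  || ((area_at f mu).+1 == area_at f la) && (la < mu)].

(** [phi f la] counts the labels that precede [la] without being inversion partners. Those of
    [far_before la] are among them, and [area_climb] supplies one more. *)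
Lemma far_before_lt_phi la : 0 < area_at f la -> #|far_before la| < phi f la.
Proof.
move=> a_gt0; rewrite phiE ltn_subRL position_card dinv_at_card.
have dis : dinv_below la :&: far_before la = set0.
  by apply/setP=> mu; rewrite !inE; lia.
have -> : #|dinv_below la| + #|far_before la| = #|dinv_below la :|: far_before la|.
  by rewrite cardsU dis cards0 subn0.
apply: proper_card; apply/properP; split.
  by apply/subsetP => mu; rewrite !inE /precedes; lia.
case: (@area_climb la (area_at f la).-1); first by rewrite prednK.
rewrite prednK // => rho [ka [a_rho a_ka lt_rho_ka f_rho f_ka]].
(* The position of la counts one more label: rho if rho < la, and ka otherwise. *)
have [lt_rho|le_rho] := ltnP rho la.
  by exists rho; rewrite !inE /precedes; move: f_ka; rewrite -f_rho; lia.
exists ka; rewrite !inE /precedes; last by lia.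
have : f ka != f la.
  by apply/eqP=> /(area_col_inj a_ka) eq_ka; move: lt_rho_ka; rewrite eq_ka; lia.
by rewrite -val_eqE /=; lia.
Qed.

(** [far_before la] is closed under [before]-predecessors, hence an initial segment of the diagonal
    word. *)
Lemma far_before_index la mu : #|far_before la| <= index mu diagonal_word ->
  mu \notin far_before la.
Proof.
move=> le_idx; apply: contraTN le_idx => far_mu.
rewrite -ltnNge index_diagonal_word; apply: proper_card; apply/properP; split.
  by apply/subsetP => x; move: far_mu; rewrite !inE /before; lia.
by exists mu; rewrite // inE before_irr.
Qed.

End ParkingFunction.

(** * The choices made by [pmaj] on [phi f] *)

Lemma pmaj_stepE n (g : PF n) (B : {set 'I_n}) (s : nat) (m t : 'I_n) :
    let B' := B :|: g @^-1: [set m] in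
    t \in B' ->
    (forall a, a \in B' -> if t < s then (a < s) ==> (a <= t) else s <= a <= t) ->
  pmaj_step g (B, s) m = (B' :\ t, val t).
Proof.
move=> B' tB' tmax; rewrite /pmaj_step -/B' /=.
set Y := if _ then _ else _.
have tY : t \in Y.
  (* If [s <= t], the hypothesis puts all of [B'] at or above [s], so no label is available below
     [s]. *)
  rewrite /Y; case: ifP => // /set0Pn[a]; rewrite inE => /andP[aB' lt_as].
  have := tmax a aB'.
  by case: ifP => [lt_ts _|]; [rewrite inE tB' | lia].
have Ymax a : a \in Y -> a <= t.
  rewrite /Y; case: ifP => [_|/eqP X0].
    by rewrite inE => /andP[/tmax + lt_as]; rewrite lt_as; case: ifP; lia.
  move=> /tmax; case: ifP => [lt_ts|]; last by lia.
  by have := in_set0 t; rewrite -X0 inE tB' lt_ts.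
have -> : \max_(a in Y) a = t.
  by apply/eqP; rewrite eqn_leq leq_bigmax_cond // andbT; apply/bigmax_leqP.
by congr (_, _); apply/setP=> a; rewrite !inE andbC.
Qed.

Section PmajPhi.
Variables (n : nat) (f : PF n).
Let tau := diagonal_word f.

Lemma tau_uniq : uniq tau. Proof. exact: order_word_uniq. Qed.
Lemma mem_tau la : la \in tau. Proof. exact: mem_order_word. Qed.

(** Loop invariant: the first [m] labels of [tau] have been removed. The [n] put in front of [tau]
    is the initial value of sigma, so entry [m] is the label chosen last. *)
Lemma foldl_pmaj_step m : m <= n ->
  foldl (pmaj_step (phi f)) (set0, n) (take m (enum 'I_n)) =
  ([set a : 'I_n | (phi f a < m) && (m <= index a tau)],
   nth n (n :: map val tau) m).
Proof.
move: (phi f) (phi_le_index f) (@far_before_lt_phi n f) => g g_le far_lt.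
elim: m => [|m IHm] lt_mn.
  by rewrite take0 /=; congr (_, _); apply/setP => a; rewrite !inE ltn0.
pose om := Ordinal lt_mn; pose t := nth om tau m.
have lt_m : m < size tau by rewrite size_diagonal_word.
have idx_t : index t tau = m by rewrite index_uniq ?tau_uniq.
rewrite (take_nth om) ?size_enum_ord // -cats1 foldl_cat IHm 1?ltnW //=.
have -> : nth om (enum 'I_n) m = om.
  by apply: val_inj; rewrite /= nth_enum_ord.
have eqB : [set a : 'I_n | g a < m & m <= index a tau]
    :|: g @^-1: [set om] = [set a | (g a <= m) && (m <= index a tau)].
  apply/setP => a; rewrite !inE -val_eqE [val om]/=.
  rewrite -[\val (g a)]/(nat_of_ord (g a)) [g a <= m]leq_eqVlt orbC.
  (* A label entering at step [m] has index at least [m] by [g_le], so it has not been chosen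
     yet. *)
  by case: eqVneq (g_le a) => [-> ->|_ _]; rewrite ?ltnn.
rewrite (pmaj_stepE (t := t)) eqB.
- rewrite /= (nth_map om) //; congr (_, _); apply/setP => a; rewrite !inE.
  have -> : (a == t) = (index a tau == m).
    rewrite -idx_t; apply/eqP/eqP => [->//|].
    by apply: (index_inj a); apply: mem_tau.
  by rewrite andbCA ltnS [m < _]ltn_neqAle [m == _]eq_sym.
- by rewrite inE idx_t leqnn andbT -[X in _ <= X]idx_t g_le.
move=> a; rewrite inE => /andP[g_a idx_a].
have t_a : t = a \/ before f t a.
  have [->|ne] := eqVneq t a; [by left | right].
  rewrite -index_diagonal_word_lt -/tau idx_t ltn_neqAle idx_a andbT.
  by apply: contra_neq ne => eq_m; rewrite /t eq_m nth_index ?mem_tau.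
have := far_lt a => {}far_lt.
case: m => [|m] in lt_mn om t lt_m idx_t g_a idx_a t_a eqB IHm *.
  (* At the first step [g a] is 0, so [a] has area 0 by [far_lt], and [tau] lists the labels of area
     0 decreasingly. *)
  rewrite /= ltn_ord; apply/implyP => _.
  by case: t_a => [->//|]; move: far_lt; rewrite /before; lia.
pose s := nth om tau m.
have lt_m' : m < size tau by rewrite ltnW.
have idx_s : index s tau = m by rewrite index_uniq ?tau_uniq.
rewrite /= (nth_map om) // -/s /=.
have s_t : before f s t by rewrite -index_diagonal_word_lt -/tau idx_s idx_t.
have := @far_before_index n f a s; have := @far_before_index n f a t.
rewrite -/tau idx_s idx_t !inE.
case: t_a => [eq_t|t_a].
  by move=> _ _; rewrite -eq_t leqnn implybT andbT; case: ltnP.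
have [a0|a_gt0] := posnP (area_at f a).
  by move: s_t t_a; rewrite /before a0; case: (ltnP t s); lia.
(* Hence [s] and [t] lie outside [far_before a]: each has the area of [a] and is larger than [a], or
   has area one less and is smaller. Going down cyclically from [s], [t] is met before [a]. *)
have far_m : #|far_before f a| <= m by move: (far_lt a_gt0); lia.
move=> /(_ (leqW far_m)) ? /(_ far_m) ?.
by move: s_t t_a; rewrite /before; case: (ltnP t s); lia.
Qed.

Lemma sigma_pmaj_phi : sigma_pmaj (phi f) = map val tau.
Proof.
have sz : size (sigma_pmaj (phi f)) = n.
  by rewrite size_map size_scanl size_enum_ord.
apply: (@eq_from_nth _ 0) => [|i]; first by rewrite sz size_map size_diagonal_word.
rewrite sz => lt_in; rewrite (nth_map (set0, 0)) ?size_scanl ?size_enum_ord //.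
rewrite nth_scanl ?size_enum_ord // foldl_pmaj_step //=.
by apply: set_nth_default; rewrite size_map size_diagonal_word.
Qed.

(** * Areas along the diagonal word *)

Lemma tau_path la s : tau = la :: s ->
  area_at f la = 0 /\
  path (fun la mu => area_at f mu == area_at f la + (la < mu)) la s.
Proof.
move=> tauE; split.
  apply/eqP; rewrite -leqn0 leqNgt; apply/negP => a_gt0.
  have [rho [_ [a_rho _ _ _ _]]] := area_climb a_gt0.
  have : before f rho la by rewrite /before a_rho a_gt0.
  by rewrite -index_diagonal_word_lt -/tau tauE /= eqxx ltn0.
apply/(pathP la) => i lt_i; rewrite -tauE.
have lt_i1 : i.+1 < size tau by rewrite tauE.
have -> : nth la s i = nth la tau i.+1 by rewrite tauE.
set x := nth la tau i; set y := nth la tau i.+1.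
have idx_x : index x tau = i by rewrite index_uniq ?tau_uniq // ltnW.
have idx_y : index y tau = i.+1 by rewrite index_uniq ?tau_uniq.
have x_y : before f x y by rewrite -index_diagonal_word_lt -/tau idx_x idx_y.
have between z : before f x z -> before f z y -> False.
  by rewrite -!index_diagonal_word_lt -/tau idx_x idx_y; lia.
have [eq_a|ne_a] := eqVneq (area_at f x) (area_at f y).
  by move: x_y; rewrite /before; lia.
have lt_a : area_at f x < area_at f y by move: x_y; rewrite /before; lia.
(* As neither [rho] nor [ka] fits strictly between the neighbours [x] and [y], the area of [y] is
   that of [ka], and [x <= rho < ka <= y]. *)
have [rho [ka [a_rho a_ka lt_rk _ _]]] := area_climb lt_a.
by have := between rho; have := between ka; rewrite /before; lia.
Qed.

Lemma pmaj_phi : pmaj (phi f) = area f.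
Proof.
rewrite /pmaj sigma_pmaj_phi.
have -> : area f = \sum_(la <- tau) area_at f la.
  rewrite /area [RHS](perm_big (enum 'I_n)) ?big_enum //.
  exact: permEl (perm_sort _ _).
case: tau tau_path => [|la s] tau_path; first by rewrite /maj big_geq // big_nil.
have [a_la la_s] := tau_path _ _ erefl.
by rewrite -(maj_rev_levels la_s) a_la muln0 addn0.
Qed.

End PmajPhi.

Theorem theorem7p1 (n : nat) (hn : 1 <= n) (f : PF n) : pmaj (phi f) = area f.
Proof. exact: pmaj_phi. Qed.
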